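(* Let $l\ge 1$ and let $S=\{(p_i,q_i)\mid i=1,\dots,l\}\subset(\{-1\}\cup\mathbb{N})\times\mathbb{N}$ be a set of $l$ distinct pairs with $p_i+q_i\ge 1$ for all $i$. Then the dimension of the symmetry component $\mathbf{V}(I_{sym})\subset\mathbb{C}^{2l}$ of the polynomial system with index set $S$ is equal to $l$ if all coefficients of the nonlinear terms on the right-hand side of the system are resonant (that is, $p_i=q_i$ for all $i$), and is equal to $l+1$ otherwise.
   Context: $\mathbb{N}$ denotes the nonnegative integers. The set $S$ indexes the coefficients of the polynomial differential system $$\dot x=x-\sum_{(p,q)\in S}a_{pq}x^{p+1}y^q,\qquad \dot y=-\Big(y-\sum_{(p,q)\in S}b_{qp}x^qy^{p+1}\Big).$$ A coefficient is called resonant if it is of the form $a_{kk}$ or $b_{kk}$. $\mathbb{C}[a,b]$ is the polynomial ring in the $2l$ variables $a_{p_iq_i},b_{q_ip_i}$, $i=1,\dots,l$. Define $L:\mathbb{N}^{2l}\to\mathbb{Z}^2$ by $$L(\nu)=\binom{p_1}{q_1}\nu_1+\cdots+\binom{p_l}{q_l}\nu_l+\binom{q_l}{p_l}\nu_{l+1}+\cdots+\binom{q_1}{p_1}\nu_{2l}.$$ $\mathcal{M}$ is the monoid of all $\nu\in\mathbb{N}^{2l}$ such that $L(\nu)=\binom{k}{k}$ for some $k\in\mathbb{N}$. For $\nu\in\mathbb{N}^{2l}$, $[\nu]$ denotes the monomial $a_{p_1q_1}^{\nu_1}\cdots a_{p_lq_l}^{\nu_l}\,b_{q_lp_l}^{\nu_{l+1}}\cdots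 b_{q_1p_1}^{\nu_{2l}}$, and $\bar\nu=(\nu_{2l},\nu_{2l-1},\dots,\nu_1)$. The Sibirsky ideal is $I_{sym}=\langle[\nu]-[\bar\nu]\mid\nu\in\mathcal{M}\rangle\subset\mathbb{C}[a,b]$, and $\mathbf{V}(I_{sym})$, its zero set in $\mathbb{C}^{2l}$, is called the symmetry component. Dimension means dimension as an affine algebraic variety. *)

(* Defs.v *)
From HB Require Import structures.
From mathcomp Require Export all_boot all_order all_algebra.
From mathcomp Require Export classical_sets reals complex mpoly.

Set Implicit Arguments.
Unset Strict Implicit.
Unset Printing Implicit Defensive.

Import Order.TTheory GRing.Theory Num.Theory.
Local Open Scope classical_set_scope.
Local Open Scope ring_scope.

Section AffineVarieties.
Variables (K : fieldType) (n : nat).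

Definition point : Type := 'I_n -> K.

Definition zero_set (F : set {mpoly K[n]}) : set point :=
  [set x | forall f, F f -> f.@[x] = 0].

Definition ideal_gen (G : set {mpoly K[n]}) : set {mpoly K[n]} :=
  [set f | exists s : seq ({mpoly K[n]} * {mpoly K[n]}),
     (forall hg, hg \in s -> G hg.2) /\ f = \sum_(hg <- s) hg.1 * hg.2].

Definition zclosed (Z : set point) : Prop := exists F, Z = zero_set F.

Definition zirreducible (Z : set point) : Prop :=
  Z !=set0 /\
  forall A B : set point, zclosed A -> zclosed B ->
    Z = A `|` B -> Z = A \/ Z = B.

(* Z_0 < Z_1 < ... < Z_d, a chain with d strict inclusions. *)
Definition irreducible_chain (V : set point) (d : nat) : Prop :=
  exists Z : 'I_d.+1 -> set point,
    (forall i, [/\ zclosed (Z i), zirreducible (Z i) & Z i `<=` V]) /\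
    (forall i j : 'I_d.+1, (i < j)%N -> Z i `<` Z j).

(* The dimension of V is d: the supremum of the lengths of chains of
   irreducible closed subsets of V is attained and equals d. *)
Definition has_dimension (V : set point) (d : nat) : Prop :=
  irreducible_chain V d /\
  forall m, irreducible_chain V m -> (m <= d)%N.

End AffineVarieties.

Section Sibirsky.
Variables (l : nat) (p q : 'I_l -> int).

(* The index of the j-th variable in the ordering
   a_(p_1 q_1), ..., a_(p_l q_l), b_(q_l p_l), ..., b_(q_1 p_1);
   note the reversed order of the b's. *)
Definition coef_index (j : 'I_(l + l)) : int * int :=
  match fintype.split j with
  | inl i => (p i, q i)
  | inr i => (q (rev_ord i), p (rev_ord i))
  end.

Definition resonant (j : 'I_(l + l)) : Prop :=
  (coef_index j).1 = (coef_index j).2.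

Definition Lmap (nu : 'X_{1..l + l}) : int * int :=
  \sum_(j < l + l) coef_index j *+ nu j.

Definition monoidM : set 'X_{1..l + l} :=
  [set nu | exists k : nat, Lmap nu = (k%:Z, k%:Z)].

Definition mnm_bar (nu : 'X_{1..l + l}) : 'X_{1..l + l} :=
  [multinom nu (rev_ord i) | i < l + l].

Definition sibirsky_ideal (K : fieldType) : set {mpoly K[l + l]} :=
  ideal_gen [set f | exists2 nu, monoidM nu & f = 'X_[nu] - 'X_[mnm_bar nu]].

Definition symmetry_component (K : fieldType) : set (point K (l + l)) :=
  zero_set (@sibirsky_ideal K).

End Sibirsky.

Arguments sibirsky_ideal {l} p q K.
Arguments symmetry_component {l} p q K.

(* Main.v *)
Require Import Defs.
From mathcomp Require Import boolp zify.
Import Order.TTheory GRing.Theory Num.Theory.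
Local Open Scope ring_scope.

(** Write the coordinates as x_j, with x_(rev j) the partner of x_j (the a and b
coefficients of one pair), and let w_j = P_j - Q_j, where (P_j, Q_j) is the
index of x_j, so that w_(rev j) = - w_j. Since every P_j + Q_j is positive, the
monoid M consists of all nu with sum_j nu_j w_j = 0. Call e_j = max(w_j, 0) the
excess of x_j.

Upper bound. If two monomials x^m and x^m' have the same degree in each pair of
partners and the same weight sum_j m_j e_j, then, after division by their
greatest common divisor, they become x^theta and x^(bar theta) with theta in M;
so they agree on the symmetry component V ([symmetry_component_eq_meval]). Hence
the polynomials of degree at most N define on V a space of functions of
dimension at most (N+1)^l (W N + 1), where W = sum_j e_j
([hilbert_ge_symmetry_component]). This is O(N^(l+1)), and O(N^l) when all the
coefficients are resonant, for then W = 0.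

On the other hand, a chain Z_0 < ... < Z_m of irreducible closed sets forces
growth of order N^m. Indeed, if f vanishes on Z but not on the larger
irreducible set Z', then multiplication by f is injective on functions on Z' and
has its image in the kernel of the restriction to Z. The Hilbert function
therefore satisfies h_Z'(N) >= h_Z(N) + h_Z'(N - deg f), which is Pascal's rule,
and h_Z_m(e k) >= binomial(k + m, m) for some e ([chain_hilbert_ge]). Comparing
the two rates of growth bounds m ([bin_growth_leq]).

Lower bound. V contains all the points (r_j t^(e_j))_j with r_(rev j) = r_j.
They form the image of an affine space under a polynomial map, and so do those
with t = 1 and with r_j = 0 for k <= j < l. Two points of such an image are
joined by a polynomial curve inside it, which makes its Zariski closure
irreducible ([zirreducible_zclosure]). The closures of the latter images, for k
= 0, ..., l, form a chain of length l; when some w_j is nonzero, letting t vary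
gives one more step, because x_j - x_(rev j) vanishes when t = 1 but not when t
= 0, r = (1, ..., 1) and w_j is nonzero. *)

Set Implicit Arguments.
Unset Strict Implicit.
Unset Printing Implicit Defensive.

Local Open Scope classical_set_scope.

(** * Hilbert functions and chains of irreducible closed sets *)

Section HilbertFunction.
Variables (K : fieldType) (n : nat).
Implicit Types (X Z V : set (point K n)) (f : {mpoly K[n]}).

(** A lower bound d for the Hilbert function of X at N, given by d linearly
independent functions on X. This form avoids constructing the quotient of the
space of polynomials of degree at most N. The multinomial size is one more than
the degree. *)
Definition hilbert_ge X (N d : nat) : Prop :=
  exists g : 'I_d -> {mpoly K[n]},
    (forall i, (msize (g i) <= N.+1)%N) /\
    forall c : 'I_d -> K,
      (forall x, X x -> \sum_i c i * (g i).@[x] = 0) -> forall i, c i = 0.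

Lemma hilbert_ge_leq X N N' d :
  (N <= N')%N -> hilbert_ge X N d -> hilbert_ge X N' d.
Proof.
move=> leN [g [szg indep]]; exists g; split=> // i.
by apply: leq_trans (szg i) _.
Qed.

Lemma hilbert_ge_subset X Z N d :
  X `<=` Z -> hilbert_ge X N d -> hilbert_ge Z N d.
Proof.
move=> XZ [g [szg indep]]; exists g; split=> // c c0.
by apply: indep => x /XZ/c0.
Qed.

Lemma hilbert_ge1 X N : X !=set0 -> hilbert_ge X N 1.
Proof.
move=> [x Xx]; exists (fun=> 1); split=> [i|c c0 i]; first by rewrite msize1.
have := c0 x Xx; rewrite big_ord1 rmorph1 mulr1.
by rewrite (ord1 i).
Qed.

(** The coordinate ring of an irreducible closed set is a domain: if f g = 0 on
Z, then Z is covered by the zero loci of f and of g in Z. *)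
Lemma zirreducible_mulf_eq0 Z f g :
  zclosed Z -> zirreducible Z ->
  (forall x, Z x -> f.@[x] * g.@[x] = 0) ->
  (forall x, Z x -> f.@[x] = 0) \/ (forall x, Z x -> g.@[x] = 0).
Proof.
move=> [F ZF] [_ irr] fg0.
have zcl h : zclosed (Z `&` zero_set [set h]).
  exists (F `|` [set h]); rewrite ZF; apply/seteqP; split=> x /=.
    by move=> [Fx hx] k [/Fx|/hx].
  by move=> Fhx; split=> k Fk; apply: Fhx; [left|right].
have Zx h x : Z = Z `&` zero_set [set h] -> Z x -> h.@[x] = 0.
  by move=> ->; case=> _; apply.
have [|Zf|Zg] := irr _ _ (zcl f) (zcl g).
- apply/seteqP; split=> x /=; last by move=> [[]|[]].
  move=> Zx'; have /eqP := fg0 x Zx'; rewrite mulf_eq0.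
  by case/orP=> /eqP e; [left|right]; split=> // k ->.
- by left=> x; apply: Zx.
- by right=> x; apply: Zx.
Qed.

(** The d functions independent on Z, together with the multiples by f of the d'
functions independent on Z', are independent on Z': restricting a linear
relation to Z kills the multiples of f, and the factor f of what remains can be
cancelled. *)
Lemma hilbert_ge_add Z Z' f e N N' d d' :
  zclosed Z' -> zirreducible Z' -> Z `<=` Z' ->
  (forall x, Z x -> f.@[x] = 0) -> (exists2 x, Z' x & f.@[x] != 0) ->
  (msize f <= e.+1)%N -> (N' + e <= N)%N ->
  hilbert_ge Z N d -> hilbert_ge Z' N' d' -> hilbert_ge Z' N (d + d').
Proof.
move=> clZ' irrZ' ZZ' fZ [y Z'y fy] szf leN [g [szg indg]] [h [szh indh]].
exists (fun i => match fintype.split i with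
                 | inl j => g j | inr j => f * h j end).
split=> [i|c c0].
  case: fintype.split => j; first exact: szg.
  have [->|f0] := eqVneq f 0; first by rewrite mul0r msize0.
  have [->|h0] := eqVneq (h j) 0; first by rewrite mulr0 msize0.
  rewrite msizeM // -subn1 leq_subLR; apply: leq_trans (leq_add szf (szh j)) _.
  by move: leN; clear; lia.
have sumE x : \sum_i c i * (match fintype.split i with
                            | inl j => g j | inr j => f * h j end).@[x]
    = \sum_j c (lshift d' j) * (g j).@[x]
      + f.@[x] * \sum_j c (rshift d j) * (h j).@[x].
  rewrite big_split_ord /= mulr_sumr; congr (_ + _); apply: eq_bigr => j _.
    by rewrite -[lshift d' j]/(unsplit (inl j)) unsplitK.
  rewrite -[rshift d j]/(unsplit (inr j)) unsplitK /= mevalM.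
  by rewrite mulrCA.
have cl j : c (lshift d' j) = 0.
  apply: (indg (fun j => c (lshift d' j))) => x Zx.
  by have := c0 x (ZZ' _ Zx); rewrite sumE fZ // mul0r addr0.
have cr j : c (rshift d j) = 0.
  apply: (indh (fun j => c (rshift d j))).
  pose H := \sum_j c (rshift d j) *: h j.
  have HE x : H.@[x] = \sum_j c (rshift d j) * (h j).@[x].
    by rewrite raddf_sum; apply: eq_bigr => k _ /=; rewrite mevalZ.
  have [|f0|H0] := @zirreducible_mulf_eq0 Z' f H clZ' irrZ'.
  - move=> x Z'x; have := c0 x Z'x; rewrite sumE HE big1 ?add0r // => k _.
    by rewrite cl mul0r.
  - by rewrite f0 ?eqxx in fy.
  - by move=> x Z'x; rewrite -HE H0.
by move=> i; rewrite -(splitK i); case: fintype.split => j /=.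
Qed.

(** One of the equations of Z fails somewhere on Z'. *)
Lemma proper_zclosed_separated Z Z' :
  zclosed Z -> Z `<` Z' ->
  exists2 f, (forall x, Z x -> f.@[x] = 0) & exists2 x, Z' x & f.@[x] != 0.
Proof.
move=> [F ZF] [_ nZ'Z]; apply: contrapT => nsep; apply: nZ'Z => x Z'x.
rewrite ZF => f Ff; apply/eqP; apply: contrapT => fx.
apply: nsep; exists f; first by move=> y; rewrite ZF; apply.
by exists x => //; apply/negP.
Qed.

(** With e at least the degree of each separating polynomial, the inequality of
[hilbert_ge_add] between the values at e k and e (k + 1) is Pascal's rule. *)
Lemma chain_hilbert_ge (Z : nat -> set (point K n)) m :
  (forall i, (i <= m)%N -> zclosed (Z i) /\ zirreducible (Z i)) ->
  (forall i, (i < m)%N -> Z i `<` Z i.+1) ->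
  exists e, forall k, hilbert_ge (Z m) (e * k) 'C(k + m, m).
Proof.
elim: m => [|m IH] irrZ ltZ.
  exists 0%N => k; rewrite bin0; apply: hilbert_ge1.
  by have [_ []] := irrZ 0%N (leqnn _).
have [|i im|e He] := IH; first by move=> i im; apply: irrZ; lia.
  by apply: ltZ; lia.
have [clZ _] := irrZ m (leqnSn m).
have [clZ' irrZ'] := irrZ m.+1 (leqnn _).
have ltZm := ltZ m (ltnSn m).
have [f fZ fZ'] := proper_zclosed_separated clZ ltZm.
exists (e + msize f)%N; elim=> [|k IHk].
  by rewrite add0n binn; apply: hilbert_ge1; case: irrZ'.
rewrite addnS binS [X in hilbert_ge _ _ X]addnC.
apply: (hilbert_ge_add (f := f) (e := msize f) (Z := Z m)
  (N' := ((e + msize f) * k)%N)) => //.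
- exact: properW ltZm.
- by rewrite mulnS addnC; apply: leq_add => //; apply: leq_addl.
- by apply: hilbert_ge_leq (He k.+1); rewrite leq_mul2r leq_addr orbT.
- by rewrite addSnnS.
Qed.

Lemma irreducible_chain_hilbert_ge V m :
  irreducible_chain V m ->
  exists e, forall k, hilbert_ge V (e * k) 'C(k + m, m).
Proof.
move=> [Z [irrZ ltZ]].
have [|i im|e He] := @chain_hilbert_ge (fun i => Z (inord i)) m.
- by move=> i _; have [] := irrZ (inord i).
- by apply: ltZ; rewrite !inordK //; lia.
exists e => k; apply: hilbert_ge_subset (He k).
by have [] := irrZ (inord m).
Qed.

(** Monomials in the same class define the same function on V, so V carries at
most as many independent functions as there are classes. The classes are given
by kappa: if there were more functions g_i than classes, a nonzero combination
of the g_i would have coefficients summing to zero in each class. *)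
Lemma hilbert_ge_leq_classes V N d (T : finType) (kappa : 'X_{1..n} -> T) :
  (forall m m', (mdeg m <= N)%N -> (mdeg m' <= N)%N -> kappa m = kappa m' ->
     forall x, V x -> 'X_[m].@[x] = 'X_[m'].@[x] :> K) ->
  hilbert_ge V N d -> (d <= #|T|)%N.
Proof.
move=> kappaV [g [szg indg]]; rewrite leqNgt; apply/negP => ltTd.
pose A : 'M[K]_(d, #|T|) := \matrix_(i, t)
  \sum_(m <- msupp (g i) | kappa m == enum_val t) (g i)@_m.
have kerA : kermx A != 0.
  rewrite -mxrank_eq0 mxrank_ker subn_eq0 -ltnNge.
  exact: leq_ltn_trans (rank_leq_col A) ltTd.
set v := nz_row (kermx A).
have vA : v *m A = 0 by apply/sub_kermxP; exact: nz_row_sub.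
have: v != 0 by rewrite nz_row_eq0.
move/eqP; apply; apply/rowP => i; rewrite mxE.
apply: (indg (v 0)) => x Vx.
(* The common value at x of the monomials of the class t. *)
pose rho t := if [pick m : 'X_{1..n < N.+1} | kappa m == t] is Some m
  then 'X_[m].@[x] : K else 0.
have rhoE m : (mdeg m <= N)%N -> 'X_[m].@[x] = rho (kappa m).
  move=> mN; rewrite /rho; case: pickP => [m' /eqP e|].
    by apply: kappaV => //; have := bmdeg m'; rewrite ltnS.
  move/(_ (@BMultinom n N.+1 m mN)).
  by rewrite eqxx.
have gE j : (g j).@[x] = \sum_t A j t * rho (enum_val t).
  transitivity
    (\sum_t (\sum_(m <- msupp (g j) | kappa m == t) (g j)@_m) * rho t).
    rewrite [LHS]mevalE.
    under [RHS]eq_bigr do rewrite mulr_suml big_mkcond.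
    rewrite exchange_big /= big_seq [RHS]big_seq; apply: eq_bigr => m gm.
    rewrite -big_mkcond /= (big_pred1 (kappa m)); last first.
      by move=> t; rewrite /= eq_sym.
    rewrite -rhoE ?mevalX //.
    by have := msize_mdeg_lt gm; have := szg j; lia.
  rewrite (reindex (@enum_val _ T)) /=; last exact/onW_bij/enum_val_bij.
  by apply: eq_bigr => t _; rewrite mxE.
under eq_bigr do rewrite gE mulr_sumr.
rewrite exchange_big big1 //= => t _.
under eq_bigr do rewrite mulrA.
rewrite -mulr_suml.
have := congr1 (fun B : 'rV_#|T| => B 0 t) vA.
by rewrite !mxE => ->; rewrite mul0r.
Qed.

End HilbertFunction.

Lemma bin_expn_ge k m : (k.+1 ^ m <= m`! * 'C(k + m, m))%N.
Proof.
rewrite mulnC bin_ffact; elim: m => [|m IH]; first by rewrite ffactn0.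
rewrite addnS ffactSS expnS; apply: leq_mul => //; lia.
Qed.

(** A polynomial of degree m in k outgrows one of degree d < m. Explicitly, if B
= m! c (e + 1)^d, the hypothesis at k = B gives (B + 1)^m <= B (B + 1)^d. *)
Lemma bin_growth_leq m d c e :
  (forall k, ('C(k + m, m) <= c * (e * k).+1 ^ d)%N) -> (m <= d)%N.
Proof.
move=> binle; rewrite leqNgt; apply/negP => ltdm.
have [B BE] : exists B, B = (m`! * (c * e.+1 ^ d))%N by eexists.
have: (B.+1 ^ d.+1 <= B * B.+1 ^ d)%N.
  apply: leq_trans (leq_trans (bin_expn_ge B m) _).
    by rewrite leq_pexp2l.
  rewrite [X in (_ <= X * _)%N]BE -!mulnA leq_mul2l; apply/orP; right.
  apply: leq_trans (binle B) _; rewrite leq_mul2l -expnMn; apply/orP; right.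
  have leB : ((e * B).+1 <= e.+1 * B.+1)%N by nia.
  by case: (d) => [|d']; rewrite ?expn0 ?leq_exp2r.
by rewrite expnS leq_pmul2r ?expn_gt0 // ltnn.
Qed.

(** * Irreducibility by polynomial curves *)

Section Irreducibility.
Variables (K : numFieldType) (n : nat).
Implicit Types (X Z V : set (point K n)) (f : {mpoly K[n]}).

Lemma poly_eq0_of_horner (P : {poly K}) : (forall s, P.[s] = 0) -> P = 0.
Proof.
move=> P0; apply/eqP; apply: contraT => nzP.
pose rs : seq K := [seq i%:R | i <- iota 0 (size P)].
have := @max_poly_roots _ P rs nzP; rewrite size_map size_iota ltnn; apply.
  by apply/allP => s _; apply/rootP.
by rewrite map_inj_uniq ?iota_uniq // => i j /eqP; rewrite eqr_nat => /eqP.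
Qed.

Definition zclosure X : set (point K n) :=
  zero_set [set f | forall x, X x -> f.@[x] = 0].

Lemma subset_zclosure X : X `<=` zclosure X.
Proof. by move=> x Xx f; apply. Qed.

Lemma zclosureS X Z : X `<=` Z -> zclosure X `<=` zclosure Z.
Proof. by move=> XZ x Xx f fZ; apply: Xx => y /XZ; apply: fZ. Qed.

Lemma zclosure_min X Z : zclosed Z -> X `<=` Z -> zclosure X `<=` Z.
Proof. by move=> [F ->] XF x Xx f Ff; apply: Xx => y /XF; apply. Qed.

Definition curve_connected X : Prop :=
  forall x y, X x -> X y -> exists c : 'I_n -> {poly K},
    [/\ forall s, X (fun j => (c j).[s]),
        (fun j => (c j).[0]) = x & (fun j => (c j).[1]) = y].

Lemma meval_curve (c : 'I_n -> {poly K}) f s :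
  (mmap (@polyC K) c f).[s] = f.@[fun j => (c j).[s]].
Proof.
rewrite /mmap horner_sum [RHS]mevalE; apply: eq_bigr => m _.
rewrite hornerCM /mmap1 horner_prod; congr (_ * _).
by apply: eq_bigr => j _; rewrite horner_exp.
Qed.

(** Suppose f is nonzero at x and g is nonzero at y, for x and y in X. Along a
curve in X from x to y, f and g are nonzero polynomials in the parameter, so
their product is nonzero at some point of X. Hence X cannot be covered by two
closed sets neither of which contains it. *)
Lemma zirreducible_zclosure X :
  X !=set0 -> curve_connected X -> zirreducible (zclosure X).
Proof.
move=> [x0 Xx0] connX; split; first by exists x0; apply: subset_zclosure.
move=> A B clA clB XAB.
have [XA|nXA] := pselect (X `<=` A).
  left; apply/seteqP; split; first exact: zclosure_min.
  by rewrite XAB => x; left.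
right; apply/seteqP; split; last by rewrite XAB => x; right.
apply: zclosure_min => // y Xy.
case: clA clB => F AF [G BG]; rewrite BG => g Gg.
apply: contrapT => gy; apply: nXA => x Xx; rewrite AF => f Ff.
have [c [Xc c0 c1]] := connX x y Xx Xy.
have /eqP : mmap (@polyC K) c f * mmap (@polyC K) c g = 0.
  apply: poly_eq0_of_horner => s; rewrite hornerM !meval_curve.
  have := subset_zclosure (Xc s); rewrite XAB => -[]; rewrite ?AF ?BG.
    by move=> /(_ _ Ff) ->; rewrite mul0r.
  by move=> /(_ _ Gg) ->; rewrite mulr0.
rewrite mulf_eq0 => /orP[] /eqP e0.
  by rewrite -c0 -meval_curve e0 horner0.
by case: gy; rewrite -c1 -meval_curve e0 horner0.
Qed.

(** The closures of the X k remain distinct because each separating f still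
vanishes on the closure of X k. *)
Lemma irreducible_chain_curve_connected V d (X : nat -> set (point K n)) :
  zclosed V ->
  (forall k, X k !=set0) -> (forall k, curve_connected (X k)) ->
  (forall k, (k <= d)%N -> X k `<=` V) ->
  (forall k, (k < d)%N -> X k `<=` X k.+1) ->
  (forall k, (k < d)%N -> exists2 f,
     (forall x, X k x -> f.@[x] = 0) & exists2 x, X k.+1 x & f.@[x] != 0) ->
  irreducible_chain V d.
Proof.
move=> clV X0 connX XV XS sepX.
exists (fun i => zclosure (X i)); split=> [i|i j].
  split; first by exists [set f | forall x, X i x -> f.@[x] = 0].
    exact: zirreducible_zclosure.
  by apply: zclosure_min => //; apply: XV; have := ltn_ord i; lia.
move: (ltn_ord j); rewrite ltnS; move: (val j) => {}j; elim: j => // j IH jd.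
have ltj : zclosure (X j) `<` zclosure (X j.+1).
  split; first exact/zclosureS/XS.
  have [f fX [x Xx fx]] := sepX j jd.
  by move=> /(_ x (subset_zclosure Xx)) /(_ f fX) /eqP; rewrite (negPf fx).
rewrite ltnS leq_eqVlt => /orP[/eqP-> //|/IH[]]; first by move=> *; lia.
move=> sij nsji; case: ltj => sj nsj; split; first exact: subset_trans sij sj.
by move=> sji; apply: nsj; apply: subset_trans sji sij.
Qed.

End Irreducibility.

(** * Monomials on the symmetry component *)

Section SymmetryComponent.
Variables (K : numFieldType) (l : nat) (p q : 'I_l -> int).
Implicit Types (j : 'I_(l + l)) (m nu : 'X_{1..l + l}).

(** The positive part of P_j - Q_j. The positive part at rev j is the negative
part at j, so natural numbers suffice to express the signed difference. *)
Definition excess j : nat :=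
  let: (a, b) := coef_index p q j in if b <= a then `|a - b|%N else 0%N.

Definition excess_weight nu : nat := (\sum_j nu j * excess j)%N.

Lemma coef_index_rev j :
  coef_index p q (rev_ord j) = ((coef_index p q j).2, (coef_index p q j).1).
Proof.
rewrite -(splitK j) /coef_index; case: (fintype.split j) => i /=.
  have -> : rev_ord (lshift l i) = rshift l (rev_ord i).
    by apply: val_inj => /=; have := ltn_ord i; lia.
  have -> : fintype.split (lshift l i) = inl i by exact: (unsplitK (inl i)).
  have -> : fintype.split (rshift l (rev_ord i)) = inr (rev_ord i).
    exact: (unsplitK (inr (rev_ord i))).
  by rewrite rev_ordK.
have -> : rev_ord (rshift l i) = lshift l (rev_ord i).
  by apply: val_inj => /=; have := ltn_ord i; lia.
have -> : fintype.split (rshift l i) = inr i by exact: (unsplitK (inr i)).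
suff -> : fintype.split (lshift l (rev_ord i)) = inl (rev_ord i) by [].
exact: (unsplitK (inl (rev_ord i))).
Qed.

Lemma excess_revB j :
  (excess j)%:Z - (excess (rev_ord j))%:Z =
  (coef_index p q j).1 - (coef_index p q j).2.
Proof.
rewrite /excess coef_index_rev; case: (coef_index p q j) => a b /=.
by case: (leP b a); case: (leP a b); lia.
Qed.

Lemma excess_resonant : (forall j, resonant p q j) -> forall j, excess j = 0%N.
Proof.
move=> res j; have := res j; rewrite /resonant /excess.
by case: (coef_index p q j) => a b /= ->; rewrite lexx subrr.
Qed.

Lemma excess_weight_bar nu :
  excess_weight (mnm_bar nu) = (\sum_j nu j * excess (rev_ord j))%N.
Proof.
rewrite /excess_weight (reindex_inj rev_ord_inj) /=.
by apply: eq_bigr => j _; rewrite mnmE rev_ordK.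
Qed.

Lemma LmapE nu : Lmap p q nu =
  (\sum_j (coef_index p q j).1 *+ nu j, \sum_j (coef_index p q j).2 *+ nu j).
Proof.
rewrite /Lmap; elim/big_rec3: _ => // j a b c _ ->.
by case: (coef_index p q j) => u v; rewrite /= ; congr (_, _); 
  rewrite ?raddfMn //=.
Qed.

(** The difference of the two weights is the difference of the two components of
L(nu). When the components are equal, hpq makes their sum nonnegative, so that
their common value is a natural number. *)
Lemma monoidM_excess_weight nu (hpq : forall i, 1 <= p i + q i) :
  monoidM p q nu <-> excess_weight nu = excess_weight (mnm_bar nu).
Proof.
set A := \sum_j (coef_index p q j).1 *+ nu j.
set B := \sum_j (coef_index p q j).2 *+ nu j.
have AB : A - B = (excess_weight nu)%:Z - (excess_weight (mnm_bar nu))%:Z.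
  rewrite excess_weight_bar /excess_weight -sumrB.
  rewrite -[Posz _]natz -[X in _ = _ - X]natz !natr_sum -sumrB.
  apply: eq_bigr => j _; rewrite -mulrnBl -excess_revB.
  by rewrite mulrnBl -!natz -!mulrnA mulnC [in X in _ - X]mulnC.
have ABge0 : 0 <= A + B.
  rewrite -big_split /=; apply: sumr_ge0 => j _; rewrite -mulrnDl.
  apply: mulrn_wge0; rewrite /coef_index; case: fintype.split => i /=.
    by have := hpq i; lia.
  by have := hpq (rev_ord i); lia.
rewrite /monoidM /= LmapE -/A -/B; split=> [[k [Ak Bk]]|eqw]; first by lia.
by exists `|A|%N; congr (_, _); lia.
Qed.

Lemma symmetry_componentP (x : point K (l + l)) :
  symmetry_component p q K x <->
  forall nu, monoidM p q nu -> 'X_[nu].@[x] = 'X_[mnm_bar nu].@[x].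
Proof.
split=> [Vx nu Mnu|Vx f [s [Gs ->]]].
  apply/eqP; rewrite -subr_eq0 -mevalB; apply/eqP; apply: Vx.
  exists [:: (1, 'X_[nu] - 'X_[mnm_bar nu])]; split.
    by move=> hg; rewrite inE => /eqP-> /=; exists nu.
  by rewrite big_seq1 mul1r.
rewrite raddf_sum big_seq big1 // => hg /Gs[nu Mnu /= ->].
by rewrite mevalM mevalB Vx // subrr mulr0.
Qed.

Lemma zclosed_symmetry_component : zclosed (symmetry_component p q K).
Proof. by exists (sibirsky_ideal p q K). Qed.

(** With theta the truncated difference m - m' and mu the greatest common
divisor of m and m', the equality of the pair degrees says m' = mu + bar theta,
while m = mu + theta. The equality of the weights then says that theta lies in
M. *)
Lemma symmetry_component_eq_meval (hpq : forall i, 1 <= p i + q i) m m' x :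
  symmetry_component p q K x ->
  (forall i : 'I_l, m (lshift l i) + m (rev_ord (lshift l i)) =
                    m' (lshift l i) + m' (rev_ord (lshift l i)))%N ->
  excess_weight m = excess_weight m' ->
  'X_[m].@[x] = 'X_[m'].@[x].
Proof.
move=> /symmetry_componentP Vx pairE wE.
have sumE j : (m j + m (rev_ord j) = m' j + m' (rev_ord j))%N.
  rewrite -(splitK j); case: (fintype.split j) => i /=; first exact: pairE.
  have -> : rshift l i = rev_ord (lshift l (rev_ord i)).
    by apply: val_inj => /=; have := ltn_ord i; lia.
  by rewrite rev_ordK addnC [RHS]addnC.
pose theta := (m - m')%MM; pose mu := (m - theta)%MM.
have mE : m = (mu + theta)%MM.
  by apply/mnmP => j; rewrite !(mnmDE, mnmBE); lia.
have m'E : m' = (mu + mnm_bar theta)%MM.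
  apply/mnmP => j; rewrite mnmDE [mnm_bar _ j]mnmE /mu /theta !mnmBE.
  by have := sumE j; lia.
rewrite mE m'E !mpolyXD !mevalM (Vx theta) //.
apply/(monoidM_excess_weight _ hpq).
have : excess_weight m = excess_weight m' by [].
rewrite mE m'E /excess_weight => /eqP.
under eq_bigr do rewrite mnmDE mulnDl.
under [X in _ == X]eq_bigr do rewrite mnmDE mulnDl.
by rewrite !big_split /= eqn_add2l => /eqP.
Qed.

(** Up to degree N there are N + 1 possible degrees in each of the l pairs and W
N + 1 possible weights, where W is the sum of the excesses. *)
Lemma hilbert_ge_symmetry_component (hpq : forall i, 1 <= p i + q i) N d :
  hilbert_ge (symmetry_component p q K) N d ->
  (d <= N.+1 ^ l * ((\sum_j excess j) * N).+1)%N.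
Proof.
set W := (\sum_j excess j)%N.
pose kappa m : {ffun 'I_l -> 'I_N.+1} * 'I_(W * N).+1 :=
  ([ffun i => inord (m (lshift l i) + m (rev_ord (lshift l i)))],
   inord (excess_weight m)).
have pair_le m i : (mdeg m <= N)%N ->
    (m (lshift l i) + m (rev_ord (lshift l i)) <= N)%N.
  apply: leq_trans; rewrite mdegE (bigD1 (lshift l i)) //= leq_add2l.
  rewrite (bigD1 (rev_ord (lshift l i))) /= ?leq_addr //.
  by rewrite -val_eqE /=; have := ltn_ord i; lia.
have weight_le m : (mdeg m <= N)%N -> (excess_weight m <= W * N)%N.
  move=> mN; rewrite /W big_distrl /=; apply: leq_sum => j _.
  rewrite mulnC leq_mul2l; apply/orP; right; apply: leq_trans mN.
  by rewrite mdegE (bigD1 j) //= leq_addr.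
move/(@hilbert_ge_leq_classes _ _ _ _ _ _ kappa).
rewrite card_prod card_ffun !card_ord; apply => m m' mN m'N kappaE x Vx.
have /ffunP pairE := congr1 fst kappaE.
have weightE := congr1 (fun c => val c.2) kappaE.
apply: symmetry_component_eq_meval => // [i|].
  have := congr1 val (pairE i).
  by rewrite !ffunE /= !inordK // ltnS; exact: pair_le.
by move: weightE; rewrite /= !inordK // ltnS; apply: weight_le.
Qed.

(** * A chain of toric subsets *)

Definition toric_point (r : 'I_(l + l) -> K) (t : K) : point K (l + l) :=
  fun j => r j * t ^+ excess j.

(** For k <= l, the coordinate subspace of dimension k of the diagonal x_j =
x_(rev j): there t = 1, so that the toric point is r itself. For k = l + 1 both
constraints are void and r and t are free. The constraints are affine in (r, t),
which is what makes each piece connected by curves. *)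
Definition toric_piece k : set (point K (l + l)) :=
  [set x | exists r t, [/\ forall j, r (rev_ord j) = r j,
     forall j, (k <= j < l)%N -> r j = 0, (k <= l)%N -> t = 1
     & x = toric_point r t]].

Lemma meval_toric_point r t m :
  'X_[m].@[toric_point r t] =
  (\prod_j r j ^+ m j) * t ^+ excess_weight m.
Proof.
rewrite mevalX /excess_weight expr_sum -big_split /=.
by apply: eq_bigr => j _; rewrite exprMn -exprM mulnC.
Qed.

(** The monomials of nu and bar nu take the same value at a toric point: the
exponents of t are the two weights, equal on M, and the factors in r are
exchanged by j -> rev j, as r is symmetric. *)
Lemma toric_piece_subset k (hpq : forall i, 1 <= p i + q i) :
  toric_piece k `<=` symmetry_component p q K.
Proof.
move=> x [r [t [rE _ _ ->]]]; apply/symmetry_componentP => nu.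
move=> /(monoidM_excess_weight _ hpq) eqw.
rewrite !meval_toric_point -eqw; congr (_ * _).
rewrite (reindex_inj rev_ord_inj) /=.
by apply: eq_bigr => j _; rewrite mnmE rE.
Qed.

(** Join the parameters (r, t) and (r', t') by a segment; all the exponents of t
are natural numbers, so its image is a polynomial curve. *)
Lemma curve_connected_toric_piece k : curve_connected (toric_piece k).
Proof.
move=> _ _ [r [t [rE r0 t1 ->]]] [r' [t' [r'E r'0 t'1 ->]]].
pose line (a b : K) : {poly K} := a%:P + (b - a) *: 'X.
have lineE a b s : (line a b).[s] = a + (b - a) * s.
  by rewrite /line hornerD hornerC hornerZ hornerX.
exists (fun j => line (r j) (r' j) * line t t' ^+ excess j); split.
- move=> s; exists (fun j => (line (r j) (r' j)).[s]), (line t t').[s]; split.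
  + by move=> j; rewrite rE r'E.
  + by move=> j kj; rewrite lineE r0 // r'0 // subrr mul0r addr0.
  + by move=> kl; rewrite lineE t1 // t'1 // subrr mul0r addr0.
  + by apply/funext => j; rewrite hornerM horner_exp.
- by apply/funext => j; rewrite hornerM horner_exp !lineE !mulr0 !addr0.
- by apply/funext => j; rewrite hornerM horner_exp !lineE !mulr1 !subrKC.
Qed.

Lemma toric_piece_leS k : toric_piece k `<=` toric_piece k.+1.
Proof.
move=> x [r [t [rE r0 t1 ->]]]; exists r, t; split=> // [j kj|kl].
  by apply: r0; lia.
by apply: t1; lia.
Qed.

Lemma toric_piece_neq0 k : toric_piece k !=set0.
Proof. by exists (toric_point (fun=> 0) 1); exists (fun=> 0), 1. Qed.

Lemma toric_piece_separated k : (k < l)%N -> exists2 f : {mpoly K[l + l]},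
  (forall x, toric_piece k x -> f.@[x] = 0) &
  (exists2 x, toric_piece k.+1 x & f.@[x] != 0).
Proof.
move=> kl; have kll : (k < l + l)%N by lia.
pose j0 := Ordinal kll; exists 'X_j0.
  move=> _ [r [t [_ r0 _ ->]]]; rewrite mevalXU /toric_point r0 ?mul0r //=.
  by rewrite leqnn.
pose r j : K := ((j == j0) || (j == rev_ord j0))%:R.
exists (toric_point r 1); last first.
  by rewrite mevalXU /toric_point /r eqxx expr1n mulr1 oner_neq0.
exists r, 1; split=> // j; rewrite /r.
  rewrite (can2_eq rev_ordK rev_ordK) (inj_eq rev_ord_inj).
  by rewrite orbC.
rewrite -!val_eqE /= => kj.
by case: eqP => [|_]; [lia|]; case: eqP => [|_] //; lia.
Qed.

(** Exactly one of e_j and e_(rev j) is zero when x_j is not resonant. So at t =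
0 with r constant equal to 1, exactly one of x_j and x_(rev j) is zero. *)
Lemma toric_piece_separated_last : ~ (forall j, resonant p q j) ->
  exists2 f : {mpoly K[l + l]},
    (forall x, toric_piece l x -> f.@[x] = 0) &
    (exists2 x, toric_piece l.+1 x & f.@[x] != 0).
Proof.
move=> /existsNP[j nres]; exists ('X_j - 'X_(rev_ord j)).
  move=> _ [r [t [rE _ t1 ->]]]; rewrite mevalB !mevalXU /toric_point rE.
  by rewrite t1 // !expr1n subrr.
exists (toric_point (fun=> 1) 0).
  by exists (fun=> 1), 0; split=> // [i|]; lia.
rewrite mevalB !mevalXU /toric_point !mul1r !expr0n.
have : (excess j == 0%N) != (excess (rev_ord j) == 0%N).
  move: nres; rewrite /resonant /excess coef_index_rev.
  case: (coef_index p q j) => a b /= ab.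
  by case: (leP b a); case: (leP a b); lia.
case: (excess j == 0%N); case: (excess _ == 0%N) => //= _.
  by rewrite subr0 oner_neq0.
by rewrite sub0r oppr_eq0 oner_neq0.
Qed.

Lemma irreducible_chain_symmetry_component d (hpq : forall i, 1 <= p i + q i) :
  (forall k, (k < d)%N -> exists2 f : {mpoly K[l + l]},
     (forall x, toric_piece k x -> f.@[x] = 0) &
     (exists2 x, toric_piece k.+1 x & f.@[x] != 0)) ->
  irreducible_chain (symmetry_component p q K) d.
Proof.
apply: irreducible_chain_curve_connected.
- exact: zclosed_symmetry_component.
- exact: toric_piece_neq0.
- exact: curve_connected_toric_piece.
- by move=> k _; apply: toric_piece_subset.
- by move=> k _; apply: toric_piece_leS.
Qed.

End SymmetryComponent.

Theorem theorem3 (R : realType) (l : nat) (p q : 'I_l -> int)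
  (hl : (1 <= l)%N)
  (hp : forall i, -1 <= p i) (hq : forall i, 0 <= q i)
  (hpq : forall i, 1 <= p i + q i)
  (hdist : injective (fun i => (p i, q i))) :
  ((forall j, resonant p q j) ->
     has_dimension (symmetry_component p q R[i]) l) /\
  (~ (forall j, resonant p q j) ->
     has_dimension (symmetry_component p q R[i]) l.+1).
Proof.
split=> res; split.
- apply: irreducible_chain_symmetry_component => //.
  exact: toric_piece_separated.
- move=> m /irreducible_chain_hilbert_ge[e He].
  apply: (@bin_growth_leq _ _ 1 e) => k.
  have := hilbert_ge_symmetry_component hpq (He k).
  rewrite big1 => [|j _]; last exact: excess_resonant.
  by rewrite mul0n muln1 mul1n.
- apply: irreducible_chain_symmetry_component => // k.
  rewrite ltnS leq_eqVlt => /orP[/eqP->|]; last exact: toric_piece_separated.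
  exact: toric_piece_separated_last.
- move=> m /irreducible_chain_hilbert_ge[e He].
  apply: (@bin_growth_leq _ _ (\sum_j excess p q j).+1 e) => k.
  apply: leq_trans (hilbert_ge_symmetry_component hpq (He k)) _.
  rewrite expnSr [leqRHS]mulnCA leq_mul2l; apply/orP; right.
  by move: (\sum_j _)%N (e * k)%N => W N; nia.
Qed.
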